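(* Consider the bilinear system \[ \dot x(t) = Ax(t) + Bu(t) + \sum_{k=1}^m N_k x(t) u_k(t),\qquad y(t) = Cx(t),\quad t\ge 0, \] with $A, N_k\in\mathbb R^{n\times n}$, $B\in\mathbb R^{n\times m}$, $C\in\mathbb R^{p\times n}$, $u\in L^2$, and assume \[ \sigma\Big(A\otimes I+I\otimes A+ \sum_{k=1}^m N_k \otimes N_k\Big)\subset \mathbb C_- . \] Assume the realization $(A,B,C,N_k)$ is balanced, i.e. $P=Q=\Sigma=\operatorname{diag}(\sigma_1,\ldots,\sigma_n)>0$, where $P$ and $Q$ solve \[ A P + P A^T + \sum_{k=1}^m N_k P N_k^T = - B B^T,\qquad A^T Q + Q A + \sum_{k=1}^m N_k^T Q N_k = - C^T C, \] and partition \[ A=\begin{pmatrix}A_{11}&A_{12}\\ A_{21}&A_{22}\end{pmatrix},\ B=\begin{pmatrix}B_1\\ B_2\end{pmatrix},\ C=\begin{pmatrix}C_1& C_2\end{pmatrix},\ N_k=\begin{pmatrix}N_{k,11}&N_{k,12}\\ N_{k,21}&N_{k,22}\end{pmatrix},\ \Sigma=\begin{pmatrix}\Sigma_1&\\ &\Sigma_2\end{pmatrix}, \] with $A_{11}\in\mathbb R^{r\times r}$, $\Sigma_1\in\mathbb R^{r\times r}$, $\Sigma_2=\operatorname{diag}(\sigma_{r+1},\ldots,\sigma_n)$. Let $\hat y$ be the output of the reduced bilinear system $\dot{\hat x}=\hat A\hat x+\hat B u+\sum_{k=1}^m \hat N_k\hat x u_k$, $\hat y=\hat C\hat x$ with the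 singular perturbation approximation matrices \[ \hat A=A_{11}- A_{12} A_{22}^{-1} A_{21},\quad \hat B=B_1,\quad \hat C=C_1-C_2 A_{22}^{-1} A_{21},\quad \hat N_k=N_{k,11}-N_{k,12} A_{22}^{-1} A_{21}, \] and assume moreover $0 \notin \sigma\big(\hat A\otimes I+I\otimes \hat A+ \sum_{k=1}^m \hat N_k \otimes \hat N_k\big)$. Then, with zero initial conditions for both the full and the reduced system, \[ \sup_{t\geq 0}\left\|y(t)-\hat y(t)\right\|_2 \leq \left(\operatorname{tr}(\Sigma_2 K_{SPA})\right)^{\frac{1}{2}} \exp\left\{0.5\left\|u^{0}\right\|_{L^2}^2\right\} \left\|u\right\|_{L^2}, \] where \begin{align*} K_{SPA} = {}& B_2 B_2^T-2(A_{22}P_{g,2}+A_{21} P_{g,1})(A_{22}^{-1} A_{21})^T\\ &+ 2\sum_{k=1}^m (N_{k,22} P_{g,2}+N_{k,21}P_{g,1})(N_{k,21}-N_{k,22}A_{22}^{-1} A_{21})^T \\ &- \sum_{k=1}^m (N_{k,21}-N_{k,22}A_{22}^{-1} A_{21}) \hat P (N_{k,21}-N_{k,22}A_{22}^{-1} A_{21})^T, \end{align*} $\hat P$ solves $\hat A \hat P + \hat P \hat A^T + \sum_{k=1}^m \hat N_k \hat P \hat N_k^T = - \hat B \hat B^T$, and $P_g=\begin{pmatrix}P_{g,1}\\ P_{g,2}\end{pmatrix}$ (with $P_{g,1}\in\mathbb R^{r\times r}$) solves $A P_g + P_g \hat A^T + \sum_{k=1}^m N_k P_g \hat N_k^T =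 - B \hat B^T$.
   Context: Here $\|u\|_{L^2}^2=\int_0^\infty u^T(s)u(s)\,ds$, and $u^0=(u^0_1,\ldots,u^0_m)^T$ is the vector of control components with nonzero $N_k$: $u^0_k\equiv 0$ if $N_k=0$ and $u^0_k=u_k$ otherwise. $\mathbb C_-$ denotes the open left half complex plane. *)

(* Defs.v *)
From HB Require Import structures.
From mathcomp Require Import all_boot all_order all_algebra.
From mathcomp Require Import all_classical all_reals all_analysis.
From mathcomp Require Import mxtens complex.

Set Implicit Arguments.
Unset Strict Implicit.
Unset Printing Implicit Defensive.
Import Order.TTheory GRing.Theory Num.Theory.
Local Open Scope classical_set_scope.
Local Open Scope ring_scope.

Section Defs.
Variable R : realType.

Definition spectrum_in_Cminus (n : nat) (M : 'M[R]_n) : Prop :=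
  forall z : R[i], root (char_poly (map_mx (real_complex R) M)) z -> Re z < 0.

Definition zero_in_spectrum (n : nat) (M : 'M[R]_n) : Prop :=
  root (char_poly (map_mx (real_complex R) M)) 0.

Definition bilin_kron (n m : nat) (A : 'M[R]_n) (N : 'I_m -> 'M[R]_n)
  : 'M[R]_(n * n) :=
  A *t (1%:M : 'M[R]_n) + (1%:M : 'M[R]_n) *t A + \sum_(k < m) (N k *t N k).

Definition vnorm2 (p : nat) (v : 'cV[R]_p) : R :=
  Num.sqrt (\sum_(i < p) v i 0 ^+ 2).

Definition is_L2 (m : nat) (u : R -> 'cV[R]_m) : Prop :=
  forall k : 'I_m,
    (@lebesgue_measure R).-integrable `[0%R, +oo[ (fun s => ((u s k 0) ^+ 2)%:E).

Definition L2norm2 (m : nat) (u : R -> 'cV[R]_m) : R :=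
  \sum_(k < m) Rintegral (@lebesgue_measure R) `[0%R, +oo[ (fun s => (u s k 0) ^+ 2).

Definition L2norm2_u0 (n m : nat) (N : 'I_m -> 'M[R]_n) (u : R -> 'cV[R]_m) : R :=
  \sum_(k < m | N k != 0)
     Rintegral (@lebesgue_measure R) `[0%R, +oo[ (fun s => (u s k 0) ^+ 2).

Definition bilin_rhs (n m : nat) (A : 'M[R]_n) (B : 'M[R]_(n, m))
  (N : 'I_m -> 'M[R]_n) (x : R -> 'cV[R]_n) (u : R -> 'cV[R]_m) (s : R)
  : 'cV[R]_n :=
  A *m x s + B *m u s + \sum_(k < m) (u s k 0) *: (N k *m x s).

(* x is a (Caratheodory) solution on [0,oo) of the bilinear state equation
   with zero initial condition x(0) = 0:
   x(t) = int_0^t (A x + B u + sum_k N_k x u_k) ds  for all t >= 0. *)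
Definition bilin_solution (n m : nat) (A : 'M[R]_n) (B : 'M[R]_(n, m))
  (N : 'I_m -> 'M[R]_n) (u : R -> 'cV[R]_m) (x : R -> 'cV[R]_n) : Prop :=
  forall t : R, 0 <= t -> forall i : 'I_n,
    (@lebesgue_measure R).-integrable `[0%R, t]
        (fun s => (bilin_rhs A B N x u s i 0)%:E) /\
    x t i 0 = Rintegral (@lebesgue_measure R) `[0%R, t]
                 (fun s => bilin_rhs A B N x u s i 0).

End Defs.

(* Main.v *)
(* For a bilinear system (A, B, N) and a positive definite S with
   A S + S A^T + sum_k N_k S N_k^T + B B^T <= 0, Young's inequality gives
   V' <= |u|^2 + |u^0|^2 V along trajectories for V = x^T S^-1 x.  Gronwall's
   lemma then bounds V by |u|_{L2}^2 exp |u^0|_{L2}^2, and Cauchy-Schwarz bounds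
   |C x|^2 by tr(C S C^T) V.

   This is applied to the error system, with state (x, xhat) and Gramian
   X = [Sigma, Pg; Pg^T, Phat], through S = X + e Y with e -> 0, where Y is block
   diagonal and solves the Lyapunov equation with right-hand side -I in each
   block.  Positivity of Y and X comes from a maximum principle for Lyapunov
   operators.  For the reduced block it uses that Sigma_1 is a dual
   supersolution: with T = [I; -A22^-1 A21] one has A T = [Ahat; 0], so
   compressing the observability equation along T gives
   Ahat^T Sigma_1 + Sigma_1 Ahat + sum_k Nhat_k^T Sigma_1 Nhat_k <= 0.
   The same compression turns tr(Ce X Ce^T), where Ce = [C, -Chat], into
   tr(Sigma_2 K). *)

Require Import Defs.
From HB Require Import structures.
From mathcomp Require Import all_boot all_order all_algebra.
From mathcomp Require Import all_classical all_reals all_analysis.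
From mathcomp Require Import mxtens complex.
From mathcomp Require Import ring lra.
Import Order.TTheory GRing.Theory Num.Theory.
Local Open Scope classical_set_scope.
Local Open Scope ring_scope.

(** * Quadratic forms and positive definite matrices *)

Section QuadraticForms.
Context {R : realType} {n : nat}.
Implicit Types (M X Y : 'M[R]_n) (v w : 'cV[R]_n).

Definition qform M v w : R := (v^T *m M *m w) 0 0.
(** Symmetry is not built into [psdmx] and [pdmx]; it is carried separately as [M^T = M]. *)
Definition psdmx M := forall v, 0 <= qform M v v.
Definition pdmx M := forall v, v != 0 -> 0 < qform M v v.
Definition sqnorm v : R := qform 1%:M v v.

Lemma qformC M v w : M^T = M -> qform M v w = qform M w v.
Proof.
move=> sM; rewrite /qform -[v^T *m M *m w]trmxK mxE.
by rewrite !trmx_mul trmxK sM mulmxA.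
Qed.

Lemma qformDl M v1 v2 w : qform M (v1 + v2) w = qform M v1 w + qform M v2 w.
Proof. by rewrite /qform raddfD !mulmxDl mxE. Qed.

Lemma qformDr M v w1 w2 : qform M v (w1 + w2) = qform M v w1 + qform M v w2.
Proof. by rewrite /qform mulmxDr mxE. Qed.

Lemma qformZl M a v w : qform M (a *: v) w = a * qform M v w.
Proof. by rewrite /qform linearZ -!scalemxAl mxE. Qed.

Lemma qformZr M a v w : qform M v (a *: w) = a * qform M v w.
Proof. by rewrite /qform -scalemxAr mxE. Qed.

Lemma qform_mxD M1 M2 v w : qform (M1 + M2) v w = qform M1 v w + qform M2 v w.
Proof. by rewrite /qform mulmxDr mulmxDl mxE. Qed.

Lemma qform_mxN M v w : qform (- M) v w = - qform M v w.
Proof. by rewrite /qform mulmxN mulNmx mxE. Qed.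

Lemma qform_mxZ a M v w : qform (a *: M) v w = a * qform M v w.
Proof. by rewrite /qform -scalemxAr -scalemxAl mxE. Qed.

Lemma qform_mx_sum m (F : 'I_m -> 'M[R]_n) v w :
  qform (\sum_(k < m) F k) v w = \sum_(k < m) qform (F k) v w.
Proof. by rewrite /qform mulmx_sumr mulmx_suml summxE. Qed.

Lemma qform0 M v : qform M 0 v = 0.
Proof. by rewrite /qform trmx0 !mul0mx mxE. Qed.

Lemma qformE M v w : qform M v w = \sum_i \sum_j v i 0 * M i j * w j 0.
Proof.
rewrite /qform mxE exchange_big; apply: eq_bigr => j _ /=.
by rewrite mxE mulr_suml; apply: eq_bigr => i _; rewrite mxE.
Qed.

Lemma sqnormE v : sqnorm v = \sum_i v i 0 ^+ 2.
Proof.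
rewrite /sqnorm /qform mulmx1 mxE; apply: eq_bigr => i _.
by rewrite mxE expr2.
Qed.

Lemma sqnorm_ge0 v : 0 <= sqnorm v.
Proof. by rewrite sqnormE sumr_ge0 // => i _; rewrite sqr_ge0. Qed.

Lemma sqnorm_gt0 v : v != 0 -> 0 < sqnorm v.
Proof.
move=> v0; rewrite lt_def sqnorm_ge0 andbT; apply: contra v0 => /eqP.
rewrite sqnormE => /eqP; rewrite psumr_eq0 => [/allP h|i _]; last exact: sqr_ge0.
apply/eqP/matrixP => i j; rewrite ord1 mxE; apply/eqP.
by have := h i (mem_index_enum _); rewrite /= sqrf_eq0.
Qed.

Lemma sqr_entry_le_sqnorm v i : v i 0 ^+ 2 <= sqnorm v.
Proof.
rewrite sqnormE (bigD1 i) //= lerDl sumr_ge0 // => j _; exact: sqr_ge0.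
Qed.

Lemma qform_le_sqnorm M : exists2 d, 0 < d & forall v, `|qform M v v| <= d * sqnorm v.
Proof.
(* The entry sum already bounds the form, since [|v_i v_j| <= |v|^2]; the added 1 makes the constant
   strictly positive. *)
exists (1 + \sum_i \sum_j `|M i j|).
  rewrite ltr_wpDr //; apply: sumr_ge0 => i _; exact: sumr_ge0.
move=> v; rewrite mulrDl mul1r.
apply: le_trans (_ : _ <= (\sum_i \sum_j `|M i j|) * sqnorm v) _.
  rewrite qformE mulr_suml; apply: le_trans (ler_norm_sum _ _ _) _.
  apply: ler_sum => i _; rewrite mulr_suml; apply: le_trans (ler_norm_sum _ _ _) _.
  apply: ler_sum => j _; rewrite mulrAC normrM mulrC ler_wpM2l //.
  have := sqr_entry_le_sqnorm v i; have := sqr_entry_le_sqnorm v j.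
  set a := v i 0; set b := v j 0 => hb ha.
  rewrite ler_norml; apply/andP; split.
    have := sqr_ge0 (a + b); nra.
  have := sqr_ge0 (a - b); nra.
by rewrite lerDr sqnorm_ge0.
Qed.

(** The quadratic polynomial in [t] given by the form at [v + t w] is nonnegative; suitable values
    of [t] give the bound, also when the form is degenerate. *)
Lemma psdmx_CauchySchwarz M v w : M^T = M -> psdmx M ->
  qform M v w ^+ 2 <= qform M v v * qform M w w.
Proof.
move=> sM pM; set a := qform M v v; set b := qform M v w; set c := qform M w w.
have H t : 0 <= a + 2 * t * b + t ^+ 2 * c.
  have := pM (v + t *: w); rewrite qformDl !qformDr !qformZl !qformZr.
  rewrite (qformC M w v) // -/a -/b -/c; set e := (X in 0 <= X) => h.
  by rewrite (_ : _ + _ = e) // /e; ring.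
have c0 : 0 <= c := pM w.
have [c00|cn0] := eqVneq c 0.
  have [->|bn0] := eqVneq b 0; first by rewrite c00 expr0n mulr0.
  (* With [c = 0] the polynomial is affine, and this [t] gives it the value -1. *)
  have := H (- (a + 1) / (2 * b)); rewrite c00 mulr0 addr0.
  by rewrite (_ : 2 * _ * b = - (a + 1)); [lra|field].
(* The minimizer of the polynomial. *)
have := H (- b / c).
rewrite (_ : a + _ + _ = (a * c - b ^+ 2) / c); last by field.
by rewrite pmulr_lge0 ?subr_ge0 // invr_gt0 lt_def cn0.
Qed.

(** Cauchy-Schwarz against each basis vector bounds the square of the corresponding entry of [M v]
    by 0. *)
Lemma psdmx_null M v : M^T = M -> psdmx M -> qform M v v = 0 -> M *m v = 0.
Proof.
move=> sM pM h; apply/matrixP => i j; rewrite ord1 [RHS]mxE.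
have e : (M *m v) i 0 = qform M (delta_mx i 0) v.
  by rewrite /qform trmx_delta -mulmxA -rowE [RHS]mxE.
have := psdmx_CauchySchwarz M (delta_mx i 0) v sM pM; rewrite -e h mulr0.
by rewrite exprn_even_le0 //= => /eqP.
Qed.

Lemma pdmx_unit M : pdmx M -> M \in unitmx.
Proof.
move=> pM; rewrite -row_free_unit -kermx_eq0; apply/eqP/row_matrixP => i.
rewrite row0; have : row i (kermx M) *m M = 0 by rewrite -row_mul mulmx_ker row0.
move: (row i _) => u uM; apply/eqP; apply: contraT => u0.
have : u^T != 0 by rewrite trmx_eq0.
by move/pM; rewrite /qform trmxK uM mul0mx mxE ltxx.
Qed.

Lemma pdmx_psd M : pdmx M -> psdmx M.
Proof. by move=> pM v; have [->|/pM/ltW//] := eqVneq v 0; rewrite qform0. Qed.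

(* With [w = M^-1 v], Cauchy-Schwarz gives
   [|v|^4 = (v^T M w)^2 <= (v^T M v) (v^T M^-1 v)]. *)
Lemma pdmx_coercive M : M^T = M -> pdmx M ->
  exists2 c, 0 < c & forall v, sqnorm v <= c * qform M v v.
Proof.
move=> sM pM; have uM := pdmx_unit M pM.
have [d d0 hd] := qform_le_sqnorm (invmx M).
exists d => // v; have [->|v0] := eqVneq v 0.
  by rewrite /sqnorm !qform0 mulr0.
have := psdmx_CauchySchwarz M v (invmx M *m v) sM (pdmx_psd M pM).
rewrite {1 3}/qform trmx_mul trmx_inv sM !mulmxA mulmxK // mulmxKV //.
rewrite -/(qform (invmx M) v v).
have -> : (v^T *m v) 0 0 = sqnorm v by rewrite /sqnorm /qform mulmx1.
have := le_trans (ler_norm _) (hd v); have s0 := sqnorm_gt0 v v0.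
have := pdmx_psd M pM v.
move: (qform M v v) (qform (invmx M) v v) => a b a0 hb h.
rewrite -(ler_pM2r s0) -expr2; apply: le_trans h _.
by rewrite (mulrC d) -mulrA ler_wpM2l.
Qed.

End QuadraticForms.

Lemma qform_mulmx {R : realType} {n k} (M : 'M[R]_k) (F : 'M[R]_(n, k)) v w :
  qform (F *m M *m F^T) v w = qform M (F^T *m v) (F^T *m w).
Proof. by rewrite /qform trmx_mul trmxK !mulmxA. Qed.

Lemma qform_gram {R : realType} {n k} (F : 'M[R]_(n, k)) v :
  qform (F *m F^T) v v = sqnorm (F^T *m v).
Proof. by rewrite -{1}[F]mulmx1 qform_mulmx. Qed.

(** * Generalized Lyapunov operators *)

Section Lyapunov.
Context {R : realType} {n m : nat}.
Implicit Types (A X Y Z : 'M[R]_n) (N : 'I_m -> 'M[R]_n) (v w : 'cV[R]_n).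

Definition lyap A N X : 'M[R]_n :=
  A *m X + X *m A^T + \sum_(k < m) N k *m X *m (N k)^T.

(** The transposed family: [lyap A^T (trf N)] is the adjoint of [lyap A N] for the pairing
    [tr (X Z)], see [tr_lyap]. *)
Definition trf N k : 'M[R]_n := (N k)^T.

Lemma lyapD A N X Y : lyap A N (X + Y) = lyap A N X + lyap A N Y.
Proof.
rewrite /lyap mulmxDr mulmxDl.
under eq_bigr do rewrite mulmxDr mulmxDl.
by rewrite big_split [RHS]addrACA; congr (_ + _); exact: addrACA.
Qed.

Lemma lyapZ A N a X : lyap A N (a *: X) = a *: lyap A N X.
Proof.
rewrite /lyap -scalemxAr -scalemxAl !scalerDr scaler_sumr.
by congr (_ + _); apply: eq_bigr => k _; rewrite -scalemxAr -scalemxAl.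
Qed.

Lemma lyap_tr A N X : (lyap A N X)^T = lyap A N X^T.
Proof.
rewrite /lyap !raddfD /= raddf_sum /= !trmx_mul trmxK (addrC (_ *m A^T)).
by congr (_ + _); apply: eq_bigr => k _; rewrite !trmx_mul trmxK mulmxA.
Qed.

Lemma qform_lyap A N X v : X^T = X ->
  qform (lyap A N X) v v =
  2 * qform X (A^T *m v) v + \sum_(k < m) qform X ((N k)^T *m v) ((N k)^T *m v).
Proof.
move=> sX; rewrite /lyap !qform_mxD qform_mx_sum mulr2n mulrDl !mul1r.
congr (_ + _ + _).
- by rewrite /qform trmx_mul trmxK !mulmxA.
- by rewrite [RHS]qformC // /qform !mulmxA.
- by apply: eq_bigr => k _; rewrite /qform trmx_mul trmxK !mulmxA.
Qed.

(* The smallest [t] for which [X + t Y] is positive semidefinite cannot be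
   positive: it would give [Z = X + t Y] a null vector [v], and then
   [v^T (lyap Z) v = sum_k (N_k^T v)^T Z (N_k^T v) >= 0]. *)
Lemma lyap_psd A N X Y : X^T = X -> Y^T = Y -> pdmx Y ->
  (forall v t, v != 0 -> 0 < t ->
     qform (lyap A N X) v v + t * qform (lyap A N Y) v v < 0) ->
  psdmx X.
Proof.
move=> sX sY pY neg.
have [[v qv]|] := pselect (exists v, qform X v v < 0); last first.
  by move=> h v; rewrite leNgt; apply/negP => hv; apply: h; exists v.
exfalso.
have v0 : v != 0.
  by apply: contraTneq qv => ->; rewrite qform0 ltxx.
pose S : set R := [set t | psdmx (X + t *: Y)].
have qE t w : qform (X + t *: Y) w w = qform X w w + t * qform Y w w.
  by rewrite qform_mxD qform_mxZ.
have lbS : lbound S 0.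
  move=> t St; rewrite leNgt; apply/negP => t0.
  have := St v; rewrite qE; have := pY v v0; nra.
have S0 : S !=set0.
  have [c c0 hc] := pdmx_coercive Y sY pY.
  have [d d0 hd] := qform_le_sqnorm X.
  (* Admissible because [|X(w,w)| <= d |w|^2 <= d c Y(w,w)]. *)
  exists (d * c) => w; rewrite qE.
  have := hd w; have := hc w; rewrite ler_norml => h1 /andP[h2 _].
  have : d * sqnorm w <= d * (c * qform Y w w) by rewrite ler_pM2l.
  by rewrite mulrA; lra.
pose t := inf S.
have hi : has_inf S by split=> //; exists 0.
have t0 : 0 <= t by exact: lb_le_inf.
have pZ : psdmx (X + t *: Y).
  move=> w; have [->|w0] := eqVneq w 0; first by rewrite qform0.
  rewrite qE; have yw := pY w w0.
  (* The infimum is attained: for fixed [w], admissibility of [s] is the closed condition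
     [- X(w,w) / Y(w,w) <= s]. *)
  suff : - qform X w w / qform Y w w <= t.
    by rewrite ler_pdivrMr //; lra.
  apply: lb_le_inf => // s Ss; rewrite ler_pdivrMr //.
  by have := Ss w; rewrite qE; lra.
have sZ : (X + t *: Y)^T = X + t *: Y by rewrite raddfD /= linearZ /= sX sY.
have tgt0 : 0 < t.
  rewrite lt_def t0 andbT; apply: contraTneq qv => te.
  by have := pZ v; rewrite te scale0r addr0 -leNgt.
have [[w w0 qw]|nex] :=
    pselect (exists2 w, w != 0 & qform (X + t *: Y) w w = 0).
  have Zw := psdmx_null _ _ sZ pZ qw.
  have : qform (lyap A N (X + t *: Y)) w w < 0.
    by rewrite lyapD lyapZ qform_mxD qform_mxZ; exact: neg.
  rewrite qform_lyap // {1}/qform -[_ *m w]mulmxA Zw mulmx0 mxE mulr0 add0r.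
  rewrite ltNge sumr_ge0 // => k _; exact: pZ.
have pdZ : pdmx (X + t *: Y).
  move=> w w0; rewrite lt_def pZ andbT; apply/eqP => e; apply: nex.
  by exists w.
have [c c0 hc] := pdmx_coercive _ sZ pdZ.
have [d d0 hd] := qform_le_sqnorm Y.
(* A positive definite [Z] dominates [(d c)^-1 Y], so [t] could be lowered below the infimum. *)
have : S (t - (d * c)^-1).
  move=> w; rewrite qE mulrBl addrA -qE subr_ge0.
  rewrite ler_pdivrMl ?mulr_gt0 //.
  apply: le_trans (ler_norm _) (le_trans (hd w) _).
  by rewrite -mulrA ler_pM2l.
move/(ge_inf hi.2); apply/negP; rewrite -/t -ltNge.
by rewrite ltrBlDr ltrDl invr_gt0 mulr_gt0.
Qed.

(** At a null vector of [X] only the sum over the [N k] survives in [qform_lyap], and that sum is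
    nonnegative. *)
Lemma lyap_pd A N X : X^T = X -> psdmx X ->
  (forall v, v != 0 -> qform (lyap A N X) v v < 0) -> pdmx X.
Proof.
move=> sX pX neg v v0; rewrite lt_def pX andbT; apply/eqP => e.
have Xv := psdmx_null _ _ sX pX e.
have := neg v v0; rewrite qform_lyap // {1}/qform -[_ *m v]mulmxA Xv mulmx0 mxE.
by rewrite mulr0 add0r ltNge sumr_ge0 // => k _; exact: pX.
Qed.

Lemma tr_lyap A N X Z : \tr (lyap A N X *m Z) = \tr (X *m lyap A^T (trf N) Z).
Proof.
rewrite /lyap /trf trmxK !mulmxDl !mulmxDr !raddfD /= mulmx_suml mulmx_sumr.
rewrite !raddf_sum /=; congr (_ + _).
  rewrite addrC; congr (_ + _); first by rewrite mulmxA.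
  by rewrite -mulmxA mxtrace_mulC mulmxA.
apply: eq_bigr => k _.
by rewrite trmxK -!mulmxA mxtrace_mulC !mulmxA.
Qed.

Lemma tr_mul_rank1 X v : \tr (X *m (v *m v^T)) = qform X v v.
Proof. by rewrite mulmxA mxtrace_mulC /qform mulmxA /mxtrace big_ord1. Qed.

(** Row-major vectorization, matching the index order of [*t]; it makes [bilin_kron A N] the matrix
    of [lyap A N]. *)
Let vec X : 'cV[R]_(n * n) :=
  \col_k X (mxtens_unindex k).1 (mxtens_unindex k).2.

Lemma tens_vec X (P Q : 'M[R]_n) : (P *t Q) *m vec X = vec (P *m X *m Q^T).
Proof.
apply/matrixP => ij z; rewrite ord1 {z}.
case: (mxtens_indexP ij) => i j; rewrite !mxE mxtens_indexK /=.
rewrite (reindex (@mxtens_index n n)) /=; last first.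
  by apply: onW_bij; exists (@mxtens_unindex n n);
    [exact: mxtens_indexK|exact: mxtens_unindexK].
under [RHS]eq_bigr do rewrite !mxE mulr_suml.
rewrite exchange_big /= pair_big /=; apply: eq_bigr => -[k l] _ /=.
by rewrite tensmxE !mxE mxtens_indexK /= mulrAC.
Qed.

Lemma bilin_kron_vec A N X : bilin_kron A N *m vec X = vec (lyap A N X).
Proof.
have vecD Y Z : vec (Y + Z) = vec Y + vec Z.
  by apply/matrixP => i j; rewrite !mxE.
rewrite /bilin_kron /lyap !mulmxDl !vecD !tens_vec trmx1 mulmx1 mul1mx.
congr (_ + _); rewrite mulmx_suml.
apply: (big_ind2 (fun a b => a = vec b)) => [|a b c d -> ->|k _].
- by apply/matrixP => i j; rewrite !mxE.
- by rewrite vecD.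
- exact: tens_vec.
Qed.

Lemma vec_inj : injective vec.
Proof.
move=> X Y /matrixP h; apply/matrixP => i j.
by have := h (mxtens_index (i, j)) 0; rewrite !mxE mxtens_indexK.
Qed.

Lemma lyap_inj A N : bilin_kron A N \in unitmx -> injective (lyap A N).
Proof.
move=> uK X Y h; apply: vec_inj.
by rewrite -[vec X](mulKmx uK) -[vec Y](mulKmx uK) !bilin_kron_vec h.
Qed.

(** The solution is read off from the inverse Kronecker matrix; it is symmetric by uniqueness, since
    its transpose solves the same equation. *)
Lemma lyap_solve A N Z : bilin_kron A N \in unitmx -> Z^T = Z ->
  exists2 X, X^T = X & lyap A N X = Z.
Proof.
move=> uK sZ.
pose w := invmx (bilin_kron A N) *m vec Z.
pose X := \matrix_(i, j) w (mxtens_index (i, j)) 0.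
have wX : w = vec X.
  apply/matrixP => k z; rewrite ord1 [RHS]mxE [X _ _]mxE -surjective_pairing.
  by rewrite mxtens_unindexK.
have LX : lyap A N X = Z.
  by apply: vec_inj; rewrite -bilin_kron_vec -wX mulKVmx.
exists X => //; apply: (lyap_inj A N uK).
by rewrite -lyap_tr LX.
Qed.

Lemma bilin_kron_tr A N : bilin_kron A^T (trf N) = (bilin_kron A N)^T.
Proof.
rewrite /bilin_kron !raddfD /= raddf_sum /= !trmx_tens trmx1.
by congr (_ + _); apply: eq_bigr => k _; rewrite trmx_tens.
Qed.

(** If 0 is not an eigenvalue over the complex numbers, the complexified matrix has trivial kernel,
    and invertibility descends to the reals. *)
Lemma unitmx_zero_in_spectrum k (M : 'M[R]_k) :
  ~ zero_in_spectrum M -> M \in unitmx.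
Proof.
rewrite /zero_in_spectrum -eigenvalue_root_char => /negP.
rewrite /eigenvalue /eigenspace raddf0 subr0 negbK kermx_eq0 row_free_unit.
by rewrite map_unitmx.
Qed.

(* Stability of [lyap A N] only needs a supersolution [S] of either the
   primal or the dual inequality. *)
Lemma lyap_neg_pd A N S : bilin_kron A N \in unitmx -> S^T = S -> pdmx S ->
  (forall v, qform (lyap A N S) v v <= 0) ->
  exists X, [/\ X^T = X, pdmx X & lyap A N X = - 1%:M].
Proof.
move=> uK sS pS LS.
have [|X sX LX] := lyap_solve A N (- 1%:M) uK; first by rewrite raddfN /= trmx1.
have neg v : v != 0 -> qform (lyap A N X) v v < 0.
  by move=> v0; rewrite LX qform_mxN oppr_lt0; exact: sqnorm_gt0.
exists X; split => //; apply: (lyap_pd A N) => //.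
apply: (lyap_psd A N X S) => // v t v0 t0.
have := neg v v0; have := LS v; nra.
Qed.

(** Positivity crosses over by trace duality: if [Z] solves the dual equation with right-hand side
    [- v v^T], then [v^T X v = tr Z]. The dual maximum principle makes [Z] positive semidefinite. *)
Lemma lyap_neg_pd_dual A N S : bilin_kron A N \in unitmx -> S^T = S -> pdmx S ->
  (forall v, qform (lyap A^T (trf N) S) v v <= 0) ->
  exists X, [/\ X^T = X, pdmx X & lyap A N X = - 1%:M].
Proof.
move=> uK sS pS LS.
have uKt : bilin_kron A^T (trf N) \in unitmx.
  by rewrite bilin_kron_tr unitmx_tr.
have [Q [sQ pQ LQ]] := lyap_neg_pd _ _ S uKt sS pS LS.
have [|X sX LX] := lyap_solve A N (- 1%:M) uK; first by rewrite raddfN /= trmx1.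
exists X; split => //; apply: (lyap_pd A N) => //; last first.
  by move=> v v0; rewrite LX qform_mxN oppr_lt0; exact: sqnorm_gt0.
move=> v.
have [|Z sZ LZ] := lyap_solve A^T (trf N) (- (v *m v^T)) uKt.
  by rewrite raddfN /= trmx_mul trmxK.
have pZ : psdmx Z.
  apply: (lyap_psd A^T (trf N) Z Q) => // w t w0 t0.
  rewrite LZ LQ !qform_mxN mulrN -opprD oppr_lt0.
  rewrite qform_gram ltr_wpDl ?sqnorm_ge0 // mulr_gt0 //.
  exact: sqnorm_gt0.
rewrite -tr_mul_rank1.
have := tr_lyap A N X Z; rewrite LX LZ mulNmx mul1mx mulmxN !raddfN /=.
move=> /oppr_inj <-; apply: sumr_ge0 => i _.
have := pZ (delta_mx i 0).
by rewrite /qform trmx_delta -rowE -colE !mxE.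
Qed.

End Lyapunov.

(** * Trajectories *)

Section Gronwall.
Context {R : realType}.
Implicit Types (H g V al be ga : R -> R) (T : R).

(** A substitute for [H' <= 0] that needs no derivative: cut [[0, T]] into equal steps shorter than
    [d], telescope, and let [e] tend to 0. *)
Lemma nonincreasing_of_small_steps H g T : 0 <= T ->
  (forall e, 0 < e -> exists2 d, 0 < d & forall s t, 0 <= s -> s <= t ->
     t <= T -> t - s < d -> H t - H s <= e * (g t - g s)) ->
  H T <= H 0.
Proof.
move=> T0 hyp; rewrite -subr_le0.
have key e : 0 < e -> H T - H 0 <= e * (g T - g 0).
  move=> e0; have [d d0 hd] := hyp e e0.
  have := archi_boundP (divr_ge0 T0 (ltW d0)); set n := Num.bound _ => hn.
  have n0 : 0 < n%:R :> R by apply: le_lt_trans hn; rewrite divr_ge0 // ltW.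
  pose h := T / n%:R.
  have h0 : 0 <= h by rewrite divr_ge0 // ltW.
  have hlt : h < d by rewrite ltr_pdivrMr // mulrC -ltr_pdivrMr.
  have hT : n%:R * h = T by rewrite mulrC divfK // gt_eqF.
  suff st k : (k <= n)%N -> H (k%:R * h) - H 0 <= e * (g (k%:R * h) - g 0).
    by have := st n (leqnn n); rewrite hT.
  elim: k => [_|k IH kn]; first by rewrite mul0r !subrr mulr0.
  have := IH (ltnW kn).
  have e1 : k.+1%:R * h = k%:R * h + h by rewrite -natr1 mulrDl mul1r.
  have le1 : k.+1%:R * h <= T by rewrite -hT ler_wpM2r // ler_nat.
  have := hd (k%:R * h) (k.+1%:R * h).
  rewrite {1 3}e1 lerDl addrAC subrr add0r => /(_ _ h0 le1 hlt).
  by rewrite mulr_ge0 // => /(_ isT); lra.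
rewrite leNgt; apply/negP => pos.
(* For this [e] the right-hand side of [key] is at most half of [H T - H 0], which is impossible for
   a positive increment. *)
have := key ((H T - H 0) / (2 * (1 + `|g T - g 0|))).
have n1 : 0 < 1 + `|g T - g 0| by rewrite ltr_wpDr.
rewrite divr_gt0 ?mulr_gt0 // => /(_ isT).
have -> (a b c : R) : a / (2 * b) * c = (a * c) / (2 * b) by rewrite mulrAC.
rewrite ler_pdivlMr ?mulr_gt0 // => hh.
have : (H T - H 0) * (g T - g 0) <= (H T - H 0) * `|g T - g 0|.
  by rewrite ler_pM2l // ler_norm.
have := normr_ge0 (g T - g 0); nra.
Qed.

(** The increment bound stands for [V' <= al' + be' V], with an error controlled by [be] and [ga].
    With the integrating factor [expR (- be t)], the short-step increments of [H] are at most [e]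
    times those of [be + ga]. *)
Lemma gronwall_small_steps V al be ga T : 0 <= T ->
  (forall s t, 0 <= s -> s <= t -> t <= T ->
     [/\ al s <= al t, be s <= be t & ga s <= ga t]) ->
  V 0 = 0 -> al 0 = 0 -> be 0 = 0 ->
  (forall t, 0 <= t -> t <= T -> 0 <= V t) ->
  (forall e, 0 < e -> exists2 d, 0 < d & forall s t, 0 <= s -> s <= t ->
     t <= T -> t - s < d ->
     V t - V s <= (al t - al s) + (V s + e) * (be t - be s) + e * (ga t - ga s)) ->
  V T <= al T * expR (be T).
Proof.
move=> T0 mono V0 a0 b0 Vge hyp.
pose H t := V t * expR (- be t) - al t.
suff : H T <= H 0.
  rewrite /H V0 a0 mul0r subrr subr_le0 expRN.
  by rewrite ler_pdivrMr // expR_gt0.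
apply: (nonincreasing_of_small_steps H (fun t => be t + ga t)) => // e e0.
have [d d0 hd] := hyp e e0; exists d => // s t s0 st tT ts.
have {hd} := hd s t s0 st tT ts.
have [] := mono s t s0 st tT; rewrite -subr_ge0 -[be s <= _]subr_ge0.
rewrite -[ga s <= _]subr_ge0 => da db dg hV.
have Vs : 0 <= V s by apply: Vge => //; exact: le_trans tT.
have : expR (- be t) <= 1.
  rewrite -expR0 ler_expR oppr_le0 -b0.
  by have [] := mono 0 t (lexx _) (le_trans s0 st) tT.
have es : expR (- be s) = expR (- be t) * expR (be t - be s).
  by rewrite -expRD; congr expR; lra.
rewrite /H es; have := expR_ge1Dx (be t - be s); have := expR_gt0 (- be t).
move: (expR (- be t)) (expR (be t - be s)) hV da db dg => E F.
rewrite (_ : be t + ga t - (be s + ga s) = (be t - be s) + (ga t - ga s)); last by lra.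
rewrite (_ : V t * E - al t - (V s * (E * F) - al s)
           = E * (V t - V s * F) - (al t - al s)); last by ring.
move: (al t - al s) (be t - be s) (ga t - ga s) => a b c hV ha hb hc E0 F1 E1.
(* Since [1 + b <= F] and [V s >= 0], the term [V s * F] absorbs [V s + V s * b]. *)
have h1 : V t - V s * F <= a + e * b + e * c by nra.
have h2 : E * (V t - V s * F) <= E * (a + e * b + e * c) by rewrite ler_pM2l.
have h3 : E * (a + e * b + e * c) <= 1 * (a + e * b + e * c).
  by rewrite ler_wpM2r // !addr_ge0 // mulr_ge0 // ltW.
lra.
Qed.

End Gronwall.

(** * Lebesgue integrals: finite sums and primitives *)

Section FiniteSums.
Context {R : realType} {I : Type}.
Notation mu := (@lebesgue_measure R).
Implicit Types (D : set R) (s : seq I) (P : pred I) (h : I -> R -> R).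

Lemma integrable_sum_EFin D s P h : measurable D ->
  (forall i, P i -> mu.-integrable D (EFin \o h i)) ->
  mu.-integrable D (EFin \o (fun x => \sum_(i <- s | P i) h i x)).
Proof.
move=> mD ih; have := @integrable_sum _ _ R mu D mD I s P (fun i => EFin \o h i) ih.
by apply: eq_integrable => // x _ /=; rewrite sumEFin.
Qed.

Lemma Rintegral_sum D s P h : measurable D ->
  (forall i, P i -> mu.-integrable D (EFin \o h i)) ->
  Rintegral mu D (fun x => \sum_(i <- s | P i) h i x)
  = \sum_(i <- s | P i) Rintegral mu D (h i).
Proof.
move=> mD ih; elim: s => [|i s IH].
  rewrite big_nil -[RHS](mul0r (fine (mu D))) -Rintegral_cst //.
  by apply: eq_Rintegral => x _; rewrite big_nil.
rewrite big_cons -IH; case: ifP => Pi.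
  rewrite -RintegralD //; last exact: integrable_sum_EFin.
    by apply: eq_Rintegral => x _; rewrite big_cons Pi.
  exact: ih.
by apply: eq_Rintegral => x _; rewrite big_cons Pi.
Qed.

End FiniteSums.

Section Primitives.
Import numFieldNormedType.Exports.
Context {R : realType}.
Notation mu := (@lebesgue_measure R).

Lemma Rintegral0_itvB (f : R -> R) (T s t : R) :
  mu.-integrable `[0, T] (EFin \o f) -> 0 <= s -> s <= t -> t <= T ->
  Rintegral mu `[0, t] f - Rintegral mu `[0, s] f = Rintegral mu `]s, t] f.
Proof.
move=> intf s0 st tT; rewrite Rintegral_itvB ?bnd_simp //.
by apply: integrableS intf => //; apply: subset_itvl; rewrite bnd_simp.
Qed.

(** Absolute continuity of the Lebesgue integral, applied to [f] cut off outside [[0, T]]; on []s,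
    t]] the cutoff changes nothing. *)
Lemma primitive_unif_continuous (f : R -> R) (T : R) :
  mu.-integrable `[0, T] (EFin \o f) -> (forall t, 0 <= f t) ->
  forall e, 0 < e -> exists2 d, 0 < d & forall s t, 0 <= s -> s <= t ->
    t <= T -> t - s < d -> Rintegral mu `]s, t] f < e.
Proof.
move=> intf f0 e e0; pose fT : R -> R := f \_ `[0, T].
have [|d [d0 hd]] := @integral_normr_continuous _ _ R mu fT _ e e0.
  by rewrite -restrict_EFin; apply/integrable_restrict => //=; rewrite setTI.
exists d => // s t s0 st tT ts.
rewrite (_ : Rintegral mu `]s, t] f = Rintegral mu `]s, t] (fun x => `|fT x|)).
  have ltd : (mu `]s, t] < d%:E)%E.
    rewrite lebesgue_measure_itv /= lte_fin.
    by case: ifP => _; rewrite ?lte_fin // -EFinD lte_fin.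
  exact: hd.
apply: eq_Rintegral => z; rewrite inE /= in_itv /= => /andP[sz zt].
rewrite /fT patchE ifT ?ger0_norm // inE /= in_itv /= (le_trans zt tT) andbT.
by rewrite (le_trans s0) // ltW.
Qed.

End Primitives.

(** * Energy estimate for bilinear trajectories *)

Section StateBound.
Context {R : realType} {n m : nat}.
Variables (A : 'M[R]_n) (B : 'M[R]_(n, m)) (N : 'I_m -> 'M[R]_n) (S : 'M[R]_n).
Hypothesis sS : S^T = S.
Hypothesis LS : forall v, qform (lyap A N S) v v + sqnorm (B^T *m v) <= 0.
Notation mu := (@lebesgue_measure R).

(* Young's inequality is applied to [2 w^T B z] in the Euclidean norm and to
   [2 z_k w^T N_k S w] in the seminorm defined by [S]. *)
Lemma dissipation (w : 'cV[R]_n) (z : 'cV[R]_m) : psdmx S ->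
  2 * (w^T *m (A *m (S *m w) + B *m z + \sum_(k < m) z k 0 *: (N k *m (S *m w)))) 0 0
  <= \sum_(k < m) z k 0 ^+ 2 + (\sum_(k < m | N k != 0) z k 0 ^+ 2) * qform S w w.
Proof.
move=> pS.
have eA : (w^T *m (A *m (S *m w))) 0 0 = qform S (A^T *m w) w.
  by rewrite /qform trmx_mul trmxK !mulmxA.
have eB : 2 * (w^T *m (B *m z)) 0 0 <= sqnorm (B^T *m w) + \sum_(k < m) z k 0 ^+ 2.
  rewrite mulmxA -[w^T *m B]trmxK trmx_mul trmxK mxE sqnormE.
  rewrite -[leRHS]big_split mulr_sumr.
  apply: ler_sum => k _; rewrite mxE /=.
  by have := sqr_ge0 ((B^T *m w) k 0 - z k 0); nra.
have eN : 2 * (w^T *m (\sum_(k < m) z k 0 *: (N k *m (S *m w)))) 0 0 <=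
    \sum_(k < m) qform S ((N k)^T *m w) ((N k)^T *m w)
    + (\sum_(k < m | N k != 0) z k 0 ^+ 2) * qform S w w.
  rewrite mulmx_sumr summxE mulr_suml [X in _ + X]big_mkcond.
  rewrite -[leRHS]big_split mulr_sumr.
  apply: ler_sum => k _ /=; rewrite -scalemxAr mxE.
  have -> : (w^T *m (N k *m (S *m w))) 0 0 = qform S ((N k)^T *m w) w.
    by rewrite /qform trmx_mul trmxK !mulmxA.
  case: eqVneq => [->|_] /=.
    by rewrite trmx0 !mul0mx !qform0 !mulr0 addr0.
  have := pS ((N k)^T *m w + (- z k 0) *: w).
  rewrite qformDl !qformDr !qformZl !qformZr (qformC S w) //; nra.
have addE (X Y : 'M[R]_1) : (X + Y) 0 0 = X 0 0 + Y 0 0 by rewrite mxE.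
have := LS w; rewrite qform_lyap // !mulmxDr !addE.
move: eB eN; rewrite eA.
move: (\sum_(k < m) _) (sqnorm _) (\sum_(k < m) _) => a b c.
by lra.
Qed.

Hypothesis pS : pdmx S.
Variables (u : R -> 'cV[R]_m) (x : R -> 'cV[R]_n).
Hypothesis L2u : is_L2 u.
Hypothesis hx : bilin_solution A B N u x.

(** [f] is the rate of the state and [g] dominates all its components; [a] and [b] are the densities
    of the squared norms of [u] and [u^0]. [V] is the energy [x^T S^-1 x], and [w = S^-1 x] is half
    its gradient. *)
Let f (i : 'I_n) (s : R) : R := bilin_rhs A B N x u s i 0.
Let g (s : R) : R := \sum_i `|f i s|.
Let a (s : R) : R := \sum_(k < m) u s k 0 ^+ 2.
Let b (s : R) : R := \sum_(k < m | N k != 0) u s k 0 ^+ 2.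
Let W : 'M[R]_n := invmx S.
Let w (t : R) : 'cV[R]_n := W *m x t.
Let V (t : R) : R := qform W (x t) (x t).

Let g_ge0 s : 0 <= g s. Proof. exact: sumr_ge0. Qed.
Let a_ge0 s : 0 <= a s. Proof. by apply: sumr_ge0 => k _; rewrite sqr_ge0. Qed.
Let b_ge0 s : 0 <= b s. Proof. by apply: sumr_ge0 => k _; rewrite sqr_ge0. Qed.

Let intf i (T : R) : 0 <= T -> mu.-integrable `[0, T] (EFin \o f i).
Proof. by move=> T0; have [] := hx T T0 i. Qed.

Let intg (T : R) : 0 <= T -> mu.-integrable `[0, T] (EFin \o g).
Proof.
move=> T0; apply: integrable_sum_EFin => // i _.
by apply: integrable_norm => //; exact: intf.
Qed.

Let int_u k (T : R) : mu.-integrable `[0, T] (EFin \o (fun s => u s k 0 ^+ 2)).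
Proof. by apply: integrableS (L2u k) => //; apply: subset_itvl. Qed.

Let inta (T : R) : mu.-integrable `[0, T] (EFin \o a).
Proof. by apply: integrable_sum_EFin => // k _; exact: int_u. Qed.

Let intb (T : R) : mu.-integrable `[0, T] (EFin \o b).
Proof. by apply: integrable_sum_EFin => // k _; exact: int_u. Qed.

Let integrable_sub (h : R -> R) (s t T : R) : mu.-integrable `[0, T] (EFin \o h) ->
  0 <= s -> s <= t -> t <= T -> mu.-integrable `]s, t] (EFin \o h).
Proof.
move=> ih s0 st tT; apply: integrableS ih => //.
by apply: subset_itv; rewrite bnd_simp.
Qed.

Let Rintegral00 (h : R -> R) : Rintegral mu `[0, 0] h = 0.
Proof. by rewrite set_itv1 Rintegral_set1. Qed.

Let x0 : x 0 = 0.
Proof.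
apply/matrixP => i j; rewrite ord1 [RHS]mxE.
by have [_ ->] := hx 0 (lexx 0) i; exact: Rintegral00.
Qed.

Let dx i (s t : R) : 0 <= s -> s <= t ->
  x t i 0 - x s i 0 = Rintegral mu `]s, t] (f i).
Proof.
move=> s0 st; have t0 := le_trans s0 st.
have [_ ->] := hx t t0 i; have [_ ->] := hx s s0 i.
by apply: (@Rintegral0_itvB _ (f i) t) => //; exact: intf.
Qed.

Let dx_le i (s t : R) : 0 <= s -> s <= t ->
  `|x t i 0 - x s i 0| <= Rintegral mu `]s, t] g.
Proof.
move=> s0 st; have t0 := le_trans s0 st; rewrite dx //.
have fi : mu.-integrable `]s, t] (EFin \o f i).
  by apply: (integrable_sub _ _ _ t) => //; exact: intf.
apply: le_trans (le_normr_Rintegral _ fi) _ => //.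
apply: le_Rintegral => //.
- exact: integrable_norm.
- by apply: (integrable_sub _ _ _ t) => //; exact: intg.
- by move=> y _; rewrite /g (bigD1 i) //= lerDl sumr_ge0.
Qed.

Let c : R := \sum_i \sum_j `|W i j|.

Let c_ge0 : 0 <= c.
Proof. by apply: sumr_ge0 => i _; exact: sumr_ge0. Qed.

Let dw_le i (s t d : R) : (forall j, `|x t j 0 - x s j 0| <= d) ->
  `|w t i 0 - w s i 0| <= c * d.
Proof.
move=> hd; have d0 : 0 <= d by exact: le_trans (hd i).
rewrite /w !mxE -sumrB; apply: le_trans (ler_norm_sum _ _ _) _.
apply: le_trans (_ : _ <= (\sum_j `|W i j|) * d) _.
  rewrite mulr_suml; apply: ler_sum => j _.
  by rewrite -mulrBr normrM ler_wpM2l.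
rewrite ler_wpM2r // /c [leRHS](bigD1 i) //= lerDl.
by apply: sumr_ge0 => k _; exact: sumr_ge0.
Qed.

Let uS : S \in unitmx. Proof. exact: pdmx_unit. Qed.
Let sW : W^T = W. Proof. by rewrite /W trmx_inv sS. Qed.

Let Sw t : S *m w t = x t. Proof. by rewrite /w mulKVmx. Qed.

Let VE t : V t = qform S (w t) (w t).
Proof. by rewrite /qform -mulmxA Sw /w trmx_mul sW. Qed.

Let V_ge0 t : 0 <= V t.
Proof. by rewrite VE; exact: pdmx_psd. Qed.

(** Difference of squares for the symmetric form [W]; it replaces differentiation of [V], as [x] is
    only a primitive of an integrable function. *)
Let dV s t : V t - V s = \sum_i (x t i 0 - x s i 0) * (w t i 0 + w s i 0).
Proof.
transitivity (((x t - x s)^T *m W *m (x t + x s)) 0 0).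
  rewrite -/(qform W _ _) -[- x s]scaleN1r qformDr !qformDl !qformZl.
  by rewrite (qformC W (x s) (x t)) // /V; ring.
rewrite -mulmxA mulmxDr mxE; apply: eq_bigr => i _.
by rewrite !mxE.
Qed.

Let dissip s : 2 * \sum_i f i s * w s i 0 <= a s + b s * V s.
Proof.
have -> : \sum_i f i s * w s i 0 = ((w s)^T *m bilin_rhs A B N x u s) 0 0.
  by rewrite mxE; apply: eq_bigr => i _; rewrite [(w s)^T _ _]mxE mulrC.
by rewrite VE; have := dissipation (w s) (u s) (pdmx_psd _ pS); rewrite Sw.
Qed.

(** Gronwall with the primitives of [a], [b] and [g]. The dissipation inequality holds pointwise
    with [w y], whereas [dV] involves [w] at the endpoints; uniform continuity makes the mismatch on
    short steps at most [e * g]. *)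
Lemma state_bound (T : R) : 0 <= T ->
  qform (invmx S) (x T) (x T) <= L2norm2 u * expR (L2norm2_u0 N u).
Proof.
move=> T0; pose al (t : R) : R := Rintegral mu `[0, t] a.
pose be (t : R) : R := Rintegral mu `[0, t] b.
pose ga (t : R) : R := Rintegral mu `[0, t] g.
have Rint_ge0 (h : R -> R) (D : set R) :
  (forall y, 0 <= h y) -> 0 <= Rintegral mu D h by move=> h0; exact: Rintegral_ge0.
have tail k : Rintegral mu `[0, T] (fun s => u s k 0 ^+ 2) <=
    Rintegral mu `[0, +oo[ (fun s => u s k 0 ^+ 2).
  rewrite -subr_ge0 Rintegral_itvB ?bnd_simp //; last exact: L2u.
  by apply: Rint_ge0 => y; exact: sqr_ge0.
have alT : al T <= L2norm2 u.
  rewrite /al Rintegral_sum //.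
  by apply: ler_sum => k _; exact: tail.
have beT : be T <= L2norm2_u0 N u.
  rewrite /be Rintegral_sum //.
  by apply: ler_sum => k _; exact: tail.
have al0 : 0 <= al T by exact: Rint_ge0.
apply: le_trans (_ : _ <= al T * expR (be T)) _; last first.
  by apply: ler_pM => //; rewrite ?expR_ge0 ?ler_expR.
have dal (s t : R) : 0 <= s -> s <= t -> t <= T -> al t - al s = Rintegral mu `]s, t] a.
  by move=> s0 st tT; apply: (@Rintegral0_itvB _ a T).
have dbe (s t : R) : 0 <= s -> s <= t -> t <= T -> be t - be s = Rintegral mu `]s, t] b.
  by move=> s0 st tT; apply: (@Rintegral0_itvB _ b T).
have dga (s t : R) : 0 <= s -> s <= t -> t <= T -> ga t - ga s = Rintegral mu `]s, t] g.
  by move=> s0 st tT; apply: (@Rintegral0_itvB _ g T) => //; exact: intg.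
apply: (gronwall_small_steps V al be ga) => //.
- move=> s t s0 st tT; split; rewrite -subr_ge0.
  + by rewrite dal //; exact: Rint_ge0.
  + by rewrite dbe //; exact: Rint_ge0.
  + by rewrite dga //; exact: Rint_ge0.
- by rewrite /V x0 qform0.
- exact: Rintegral00.
- exact: Rintegral00.
pose G := ga T.
have G0 : 0 <= G by exact: Rint_ge0.
have xG (t : R) i : 0 <= t -> t <= T -> `|x t i 0 - x 0 i 0| <= G.
  move=> t0 tT; apply: le_trans (dx_le i 0 t _ _) _ => //.
  rewrite -dga // /ga Rintegral00 subr0 -subr_ge0 dga //.
  exact: Rint_ge0.
have wG (t : R) i : 0 <= t -> t <= T -> `|w t i 0| <= c * G.
  move=> t0 tT; have := dw_le i 0 t G (fun j => xG t j t0 tT).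
  by rewrite /w x0 mulmx0 [in X in _ - X]mxE subr0.
move=> e e0.
(* Sized for two errors when the state varies by at most [eta]: [V] changes by at most
   [eta * 2 c G n], and the endpoint values of [w] contribute at most [2 c eta]. The 1 keeps [K]
   positive. *)
pose K := 1 + 2 * c * G * n%:R + 2 * c.
have cG : 0 <= 2 * c * G * n%:R by rewrite !mulr_ge0.
have K0 : 0 < K.
  by rewrite /K; have := c_ge0; lra.
pose eta := e / K.
have eta0 : 0 < eta by rewrite divr_gt0.
have etaK : eta * K = e by rewrite divfK // gt_eqF.
have [d d0 hd] := primitive_unif_continuous g T (intg T T0) g_ge0 eta eta0.
exists d => // s t s0 st tT ts.
have t0 := le_trans s0 st.
have near (p q : R) i : s <= p -> p <= q -> q <= t -> `|x q i 0 - x p i 0| <= eta.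
  move=> sp pq qt; have p0 := le_trans s0 sp.
  apply: le_trans (dx_le i p q p0 pq) _; apply/ltW/hd => //.
    exact: le_trans tT.
  by apply: le_lt_trans ts; lra.
have Vtau (y : R) : s <= y -> y <= t -> V y <= V s + e.
  move=> sy yt; rewrite -lerBlDl dV.
  apply: le_trans (ler_norm _) _; apply: le_trans (ler_norm_sum _ _ _) _.
  apply: le_trans (_ : _ <= \sum_(i < n) eta * (2 * c * G)) _.
    apply: ler_sum => i _; rewrite normrM; apply: ler_pM => //.
      exact: near.
    apply: le_trans (ler_normD _ _) _.
    have := wG y i (le_trans s0 sy) (le_trans yt tT).
    have := wG s i s0 (le_trans st tT); lra.
  rewrite sumr_const card_ord -(mulr_natr (eta * _)) -(mulrA eta) -etaK.
  rewrite ler_pM2l // /K.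
  have := c_ge0; lra.
have ia : mu.-integrable `]s, t] (EFin \o a).
  by apply: (integrable_sub _ _ _ T) => //.
have ib : mu.-integrable `]s, t] (EFin \o b).
  by apply: (integrable_sub _ _ _ T) => //.
have ig : mu.-integrable `]s, t] (EFin \o g).
  by apply: (integrable_sub _ _ _ T) => //; exact: intg.
have ifi i : mu.-integrable `]s, t] (EFin \o f i).
  by apply: (integrable_sub _ _ _ T) => //; exact: intf.
have intZl (h : R -> R) k : mu.-integrable `]s, t] (EFin \o h) ->
    mu.-integrable `]s, t] (EFin \o (fun y => k * h y)).
  by move=> ih; apply: eq_integrable (integrableZl _ k ih).
have intZr (h : R -> R) k : mu.-integrable `]s, t] (EFin \o h) ->
    mu.-integrable `]s, t] (EFin \o (fun y => h y * k)).
  by move=> ih; apply: eq_integrable (integrableZr _ k ih).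
have intD (h k : R -> R) : mu.-integrable `]s, t] (EFin \o h) ->
    mu.-integrable `]s, t] (EFin \o k) ->
    mu.-integrable `]s, t] (EFin \o (fun y => h y + k y)).
  by move=> ih ik; apply: eq_integrable (integrableD _ ih ik).
have ibV : mu.-integrable `]s, t] (EFin \o (fun y => b y * (V s + e))).
  exact: intZr.
have ige : mu.-integrable `]s, t] (EFin \o (fun y => e * g y)).
  exact: intZl.
have ifw i : mu.-integrable `]s, t] (EFin \o (fun y => f i y * (w t i 0 + w s i 0))).
  exact: intZr.
have iab : mu.-integrable `]s, t] (EFin \o (fun y => a y + b y * (V s + e))).
  exact: intD.
rewrite dal // dbe // dga // mulrC -RintegralZr // -RintegralZl //.
rewrite -RintegralD // -RintegralD //.
rewrite dV (eq_bigr (fun i => Rintegral mu `]s, t]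
    (fun y => f i y * (w t i 0 + w s i 0)))); last first.
  by move=> i _; rewrite dx // RintegralZr.
rewrite -Rintegral_sum //.
apply: le_Rintegral => //.
- exact: integrable_sum_EFin.
- exact: intD.
move=> y; rewrite /= in_itv /= -/(a y) -/(b y) -/(g y) => /andP[/ltW sy yt].
have := dissip y; have := Vtau y sy yt; have := b_ge0 y => by0 Vy hy.
have {}Vy : b y * V y <= b y * (V s + e) by rewrite ler_wpM2l.
(* Replacing [w t + w s] by [2 w y] costs at most [2 c eta <= e] per component, weighted by
   [|f i y|]; these weights sum to [g y]. *)
suff : \sum_i f i y * (w t i 0 + w s i 0) <=
       2 * \sum_i f i y * w y i 0 + e * g y by lra.
rewrite /g !mulr_sumr -[leRHS]big_split; apply: ler_sum => i _ /=.
have h1 := dw_le i y t eta (fun j => near y t j sy yt (lexx t)).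
have h2 := dw_le i s y eta (fun j => near s y j (lexx s) sy yt).
rewrite -lerBlDl -etaK.
rewrite (_ : _ - _ = f i y * ((w t i 0 - w y i 0) - (w y i 0 - w s i 0))); last by ring.
apply: le_trans (ler_norm _) _; rewrite normrM mulrC ler_wpM2r //.
apply: le_trans (ler_normB _ _) _.
have : eta * (2 * c) <= eta * K.
  by rewrite ler_pM2l // /K; lra.
by lra.
Qed.

End StateBound.

(** * From state energy to output: trace bounds *)

Lemma qform_row {R : realType} {n p} (S : 'M[R]_n) (C : 'M[R]_(p, n)) i :
  qform S (row i C)^T (row i C)^T = (C *m S *m C^T) i i.
Proof.
rewrite /qform trmxK tr_row -!row_mul mxE mxE [RHS]mxE.
by apply: eq_bigr => j _; rewrite [col _ _ _ _]mxE.
Qed.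

Lemma tr_psdmx_ge0 {R : realType} {n p} (S : 'M[R]_n) (C : 'M[R]_(p, n)) :
  psdmx S -> 0 <= \tr (C *m S *m C^T).
Proof. by move=> pS; apply: sumr_ge0 => i _; rewrite -qform_row. Qed.

Section OutputBound.
Context {R : realType} {n m p : nat}.
Variables (A : 'M[R]_n) (B : 'M[R]_(n, m)) (N : 'I_m -> 'M[R]_n).
Variables (X Y : 'M[R]_n).
Hypotheses (sX : X^T = X) (LX : lyap A N X = - (B *m B^T)).
Hypotheses (sY : Y^T = Y) (pY : pdmx Y) (LY : lyap A N Y = - 1%:M).

(** The maximum principle with comparison matrix [Y], whose right-hand side [- 1%:M] supplies the
    strict sign that [- B B^T] may lack. *)
Lemma gramian_psd : psdmx X.
Proof.
apply: (lyap_psd A N X Y) => // v t v0 t0.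
rewrite LX LY !qform_mxN qform_gram.
have := sqnorm_ge0 (B^T *m v); have := sqnorm_gt0 v v0.
rewrite /sqnorm; nra.
Qed.

(** Each entry of [C v] is the [S]-product of a row of [C] with [S^-1 v]; Cauchy-Schwarz row by row
    sums to the trace. *)
Lemma sqnorm_output (C : 'M[R]_(p, n)) (S : 'M[R]_n) (v : 'cV[R]_n) :
  S^T = S -> pdmx S ->
  sqnorm (C *m v) <= \tr (C *m S *m C^T) * qform (invmx S) v v.
Proof.
move=> sS pS; have uS := pdmx_unit S pS.
pose w := invmx S *m v.
have vE : v = S *m w by rewrite /w mulKVmx.
have -> : qform (invmx S) v v = qform S w w.
  by rewrite /qform -(mulmxA w^T) -vE /w trmx_mul trmx_inv sS.
rewrite sqnormE mulr_suml; apply: ler_sum => i _.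
have -> : (C *m v) i 0 = qform S (row i C)^T w.
  by rewrite /qform trmxK -!row_mul [RHS]mxE vE mulmxA.
rewrite -qform_row; by apply: psdmx_CauchySchwarz => //; exact: pdmx_psd.
Qed.

(* [X] may be singular; the bound is obtained for [X + e Y] and [e] tends to 0. *)
Lemma output_bound (C : 'M[R]_(p, n)) (u : R -> 'cV[R]_m) (x : R -> 'cV[R]_n) (t : R) :
  is_L2 u -> bilin_solution A B N u x -> 0 <= t ->
  sqnorm (C *m x t) <= \tr (C *m X *m C^T) * (L2norm2 u * expR (L2norm2_u0 N u)).
Proof.
move=> L2u hx t0; set M := L2norm2 u * _.
apply/ler_addgt0Pr => e e0.
set k := \tr (C *m Y *m C^T) * M.
have k1 : 0 < 1 + `|k| by rewrite ltr_wpDr.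
(* Chosen so that the perturbation contributes [d * k <= e]. *)
pose d := e / (1 + `|k|).
have d0 : 0 < d by rewrite divr_gt0.
pose S := X + d *: Y.
have sS : S^T = S by rewrite /S raddfD /= linearZ /= sX sY.
have pS : pdmx S.
  move=> v v0; rewrite qform_mxD qform_mxZ.
  by rewrite ltr_wpDl ?mulr_gt0 ?pY //; exact: gramian_psd.
have LS v : qform (lyap A N S) v v + sqnorm (B^T *m v) <= 0.
  rewrite /S lyapD lyapZ LX LY qform_mxD qform_mxZ !qform_mxN qform_gram.
  have := sqnorm_ge0 v; rewrite /sqnorm; nra.
have Vt := state_bound A B N S sS LS pS u x L2u hx t t0.
apply: le_trans (sqnorm_output C S (x t) sS pS) _.
have trS : 0 <= \tr (C *m S *m C^T).
  by apply: tr_psdmx_ge0; exact: pdmx_psd.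
apply: le_trans (ler_wpM2l trS Vt) _; rewrite -/M.
rewrite /S mulmxDr mulmxDl raddfD /= -scalemxAr -scalemxAl mxtraceZ mulrDl lerD2l.
rewrite -mulrA -/k; apply: le_trans (_ : _ <= d * (1 + `|k|)) _.
  by rewrite ler_pM2l //; have := ler_norm k; lra.
by rewrite divfK // gt_eqF.
Qed.

End OutputBound.

(** * The error system *)

Section ErrorSystem.
Context {R : realType} {n n' m p : nat}.
Variables (A : 'M[R]_n) (B : 'M[R]_(n, m)) (N : 'I_m -> 'M[R]_n).
Variables (A' : 'M[R]_n') (B' : 'M[R]_(n', m)) (N' : 'I_m -> 'M[R]_n').

Definition diag_blocks k : 'M[R]_(n + n') := block_mx (N k) 0 0 (N' k).

Lemma qform_block (X : 'M[R]_n) (Y : 'M[R]_n') v v' w w' :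
  qform (block_mx X 0 0 Y) (col_mx v v') (col_mx w w') = qform X v w + qform Y v' w'.
Proof.
rewrite /qform tr_col_mx mul_row_block !mulmx0 addr0 add0r mul_row_col.
by rewrite mxE.
Qed.

Lemma pdmx_block (X : 'M[R]_n) (Y : 'M[R]_n') :
  pdmx X -> pdmx Y -> pdmx (block_mx X 0 0 Y).
Proof.
move=> pX pY v; rewrite -[v]vsubmxK qform_block col_mx_eq0 negb_and => /orP[h|h].
  by rewrite ltr_pwDl ?pX //; exact: pdmx_psd.
by rewrite ltr_wpDl ?pY //; exact: pdmx_psd.
Qed.

Lemma lyap_block (X : 'M[R]_n) (G : 'M[R]_(n, n')) (Y : 'M[R]_n') :
  lyap (block_mx A 0 0 A') diag_blocks (block_mx X G G^T Y) =
  block_mx (lyap A N X) (A *m G + G *m A'^T + \sum_(k < m) N k *m G *m (N' k)^T)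
    (A *m G + G *m A'^T + \sum_(k < m) N k *m G *m (N' k)^T)^T (lyap A' N' Y).
Proof.
have sumE : \sum_(k < m) diag_blocks k *m block_mx X G G^T Y *m (diag_blocks k)^T =
    block_mx (\sum_(k < m) N k *m X *m (N k)^T) (\sum_(k < m) N k *m G *m (N' k)^T)
      (\sum_(k < m) N' k *m G^T *m (N k)^T) (\sum_(k < m) N' k *m Y *m (N' k)^T).
  elim: (index_enum _) => [|k s IH]; first by rewrite !big_nil block_mx0.
  rewrite !big_cons IH /diag_blocks tr_block_mx !mulmx_block !trmx0.
  by rewrite !(mul0mx, mulmx0, addr0, add0r) add_block_mx.
rewrite {1}/lyap sumE tr_block_mx !mulmx_block !trmx0.
rewrite !(mul0mx, mulmx0, addr0, add0r) !add_block_mx /lyap.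
congr block_mx; rewrite !raddfD /= raddf_sum /= !trmx_mul !trmxK (addrC (_ *m A^T)).
by congr (_ + _); apply: eq_bigr => k _; rewrite !trmx_mul trmxK mulmxA.
Qed.

Lemma bilin_rhs_col u x x' (s : R) :
  bilin_rhs (block_mx A 0 0 A') (col_mx B B') diag_blocks
    (fun t => col_mx (x t) (x' t)) u s =
  col_mx (bilin_rhs A B N x u s) (bilin_rhs A' B' N' x' u s).
Proof.
rewrite /bilin_rhs mul_block_col mul_col_mx !mul0mx addr0 add0r.
rewrite -!add_col_mx; congr (_ + _).
elim/big_ind3: _ => [|? ? ? ? ? ? -> ->|k _]; first by rewrite col_mx0.
  by rewrite add_col_mx.
by rewrite /diag_blocks mul_block_col !mul0mx addr0 add0r scale_col_mx.
Qed.

Lemma bilin_solution_col u x x' :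
  bilin_solution A B N u x -> bilin_solution A' B' N' u x' ->
  bilin_solution (block_mx A 0 0 A') (col_mx B B') diag_blocks u
    (fun t => col_mx (x t) (x' t)).
Proof.
move=> hx hx' t t0 i; case: (split_ordP i) => j ->.
  have [h1 h2] := hx t t0 j; rewrite col_mxEu h2.
  split; last by apply: eq_Rintegral => s _; rewrite bilin_rhs_col col_mxEu.
  by apply: eq_integrable h1 => // s _; rewrite bilin_rhs_col col_mxEu.
have [h1 h2] := hx' t t0 j; rewrite col_mxEd h2.
split; last by apply: eq_Rintegral => s _; rewrite bilin_rhs_col col_mxEd.
by apply: eq_integrable h1 => // s _; rewrite bilin_rhs_col col_mxEd.
Qed.

Variables (X Y : 'M[R]_n) (X' Y' : 'M[R]_n') (G : 'M[R]_(n, n')).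
Hypotheses (sX : X^T = X) (LX : lyap A N X = - (B *m B^T)).
Hypotheses (sY : Y^T = Y) (pY : pdmx Y) (LY : lyap A N Y = - 1%:M).
Hypotheses (sX' : X'^T = X') (LX' : lyap A' N' X' = - (B' *m B'^T)).
Hypotheses (sY' : Y'^T = Y') (pY' : pdmx Y') (LY' : lyap A' N' Y' = - 1%:M).
Hypothesis LG :
  A *m G + G *m A'^T + \sum_(k < m) N k *m G *m (N' k)^T = - (B *m B'^T).

(** The output error is [Ce] applied to the stacked state, so [output_bound] applies with block
    Gramian [Xe]. Vanishing of [N' k] with [N k] keeps [u^0] the same for the stacked system;
    [0 <= gap] later allows square roots to be multiplied. *)
Lemma error_bound (C : 'M[R]_(p, n)) (C' : 'M[R]_(p, n')) u x x' (t : R) :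
  (forall k, N k = 0 -> N' k = 0) -> is_L2 u ->
  bilin_solution A B N u x -> bilin_solution A' B' N' u x' -> 0 <= t ->
  let gap := \tr (C *m X *m C^T) - \tr (C *m G *m C'^T) *+ 2
             + \tr (C' *m X' *m C'^T) in
  0 <= gap /\
  sqnorm (C *m x t - C' *m x' t) <= gap * (L2norm2 u * expR (L2norm2_u0 N u)).
Proof.
move=> N0 L2u hx hx' t0 gap.
pose Ce := row_mx C (- C').
pose Xe := block_mx X G G^T X'; pose Ye := block_mx Y 0 0 Y'.
have sXe : Xe^T = Xe by rewrite /Xe tr_block_mx sX sX' trmxK.
have sYe : Ye^T = Ye by rewrite /Ye tr_block_mx sY sY' !trmx0.
have pYe : pdmx Ye by exact: pdmx_block.
have LXe : lyap (block_mx A 0 0 A') diag_blocks Xe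
    = - (col_mx B B' *m (col_mx B B')^T).
  rewrite lyap_block LX LX' LG tr_col_mx mul_col_row opp_block_mx.
  by rewrite raddfN /= trmx_mul trmxK.
have LYe : lyap (block_mx A 0 0 A') diag_blocks Ye = - 1%:M.
  have -> : Ye = block_mx Y 0 (0 : 'M[R]_(n, n'))^T Y' by rewrite trmx0.
  rewrite lyap_block LY LY'.
  rewrite mulmx0 mul0mx big1 => [|k _]; last by rewrite mulmx0 mul0mx.
  by rewrite !addr0 trmx0 scalar_mx_block opp_block_mx !oppr0.
have gapE : gap = \tr (Ce *m Xe *m Ce^T).
  rewrite /Ce /Xe mul_row_block tr_row_mx mul_row_col !mulmxDl !raddfD /= !raddfN /=.
  rewrite !(mulmxN, mulNmx) !raddfN /= opprK.
  have -> : \tr (C' *m G^T *m C^T) = \tr (C *m G *m C'^T).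
    by rewrite -[RHS]mxtrace_tr !trmx_mul trmxK mulmxA.
  by rewrite /gap mulr2n; ring.
have u0E : L2norm2_u0 diag_blocks u = L2norm2_u0 N u.
  apply: eq_bigl => k; rewrite /diag_blocks block_mx_eq0 !eqxx /=.
  by case: eqVneq => //= /N0 ->; rewrite eqxx.
have psXe := gramian_psd _ _ _ Xe Ye sXe LXe sYe pYe LYe.
split.
  by rewrite gapE; exact: tr_psdmx_ge0.
have -> : C *m x t - C' *m x' t = Ce *m col_mx (x t) (x' t).
  by rewrite mul_row_col mulNmx.
rewrite gapE -u0E.
have hxe := bilin_solution_col u x x' hx hx'.
exact: (output_bound _ _ _ Xe Ye sXe LXe sYe pYe LYe Ce u _ t L2u hxe t0).
Qed.

End ErrorSystem.

(** * The reduced system *)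

Section SingularPerturbation.
Context {R : realType} {r q m p : nat}.
Variables (A : 'M[R]_(r + q)) (B : 'M[R]_(r + q, m)) (C : 'M[R]_(p, r + q)).
Variables (N : 'I_m -> 'M[R]_(r + q)).
Variables (S1 : 'M[R]_r) (S2 : 'M[R]_q) (E : 'M[R]_(q, r)).
Variables (Ah : 'M[R]_r) (Nh : 'I_m -> 'M[R]_r) (M : 'I_m -> 'M[R]_(q, r)).

Let Sigma : 'M[R]_(r + q) := block_mx S1 0 0 S2.
Let T : 'M[R]_(r + q, r) := col_mx 1%:M (- E).

(* The reduced matrices are compressions along [T], whose columns span the
   states with [A21 x1 + A22 x2 = 0]. *)
Hypothesis AT : A *m T = col_mx Ah 0.
Hypothesis NT : forall k, N k *m T = col_mx (Nh k) (M k).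
Hypothesis obs : lyap A^T (trf N) Sigma = - (C^T *m C).

(** Along [w = T v] the full dual form equals the reduced one plus the sum of the terms
    [(M_k v)^T S2 (M_k v) >= 0], and the full form is [- |C w|^2]. *)
Lemma lyap_dual_reduced_le0 v : S1^T = S1 -> S2^T = S2 -> psdmx S2 ->
  qform (lyap Ah^T (trf Nh) S1) v v <= 0.
Proof.
move=> sS1 sS2 pS2.
have sS : Sigma^T = Sigma by rewrite /Sigma tr_block_mx sS1 sS2 !trmx0.
pose w := T *m v.
have wE : w = col_mx v (- E *m v) by rewrite /w /T mul_col_mx mul1mx.
have Aw : A *m w = col_mx (Ah *m v) 0 by rewrite mulmxA AT mul_col_mx mul0mx.
have Nw k : N k *m w = col_mx (Nh k *m v) (M k *m v).
  by rewrite mulmxA NT mul_col_mx.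
have : qform (lyap A^T (trf N) Sigma) w w <= 0.
  by rewrite obs qform_mxN -{2}[C]trmxK qform_gram oppr_le0 sqnorm_ge0.
apply: le_trans; rewrite !qform_lyap // !trmxK Aw wE qform_block qform0 addr0.
rewrite -wE lerD2l; apply: ler_sum => k _.
by rewrite /trf !trmxK Nw qform_block lerDl; exact: pS2.
Qed.

(** The observability equation replaces [C^T C], and trace duality moves the Lyapunov operator onto
    [Z]. *)
Lemma tr_output_gram Z : \tr (C *m Z *m C^T) = - \tr (Sigma *m lyap A N Z).
Proof.
rewrite mxtrace_mulC mulmxA -[C^T *m C]opprK -obs mulNmx raddfN /= tr_lyap.
rewrite trmxK; congr (- \tr (_ *m lyap _ _ _)).
by apply: funext => k; rewrite /trf trmxK.
Qed.

Lemma tr_block_diag (X : 'M[R]_(r + q, r)) (Y : 'M[R]_(r + q, q)) :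
  \tr (Sigma *m row_mx X Y) = \tr (S1 *m usubmx X) + \tr (S2 *m dsubmx Y).
Proof.
rewrite -{1}[X]vsubmxK -{1}[Y]vsubmxK -block_mxEh mulmx_block mxtrace_block.
by rewrite !mul0mx addr0 add0r.
Qed.

Hypothesis reach : lyap A N Sigma = - (B *m B^T).
Variables (Phat : 'M[R]_r) (Pg : 'M[R]_(r + q, r)).
Hypothesis hPhat : lyap Ah Nh Phat = - (usubmx B *m (usubmx B)^T).
Hypothesis hPg : A *m Pg + Pg *m Ah^T + \sum_(k < m) N k *m Pg *m (Nh k)^T
  = - (B *m (usubmx B)^T).

(** Each of the three traces is [b1] plus a term weighted by [S2]; with coefficients 1, -2, 1 the
    [b1] contributions cancel. *)
Lemma tr_gap :
  \tr (C *m Sigma *m C^T) - \tr (C *m Pg *m (C *m T)^T) *+ 2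
    + \tr (C *m T *m Phat *m (C *m T)^T) =
  \tr (S2 *m (dsubmx B *m (dsubmx B)^T - (dsubmx (A *m Pg) *m E^T) *+ 2
     + (\sum_(k < m) dsubmx (N k *m Pg) *m (M k)^T) *+ 2
     - \sum_(k < m) M k *m Phat *m (M k)^T)).
Proof.
pose b1 := \tr (S1 *m (usubmx B *m (usubmx B)^T)).
have TT : T^T = row_mx 1%:M (- E^T) by rewrite /T tr_col_mx trmx1 raddfN.
have ATT : T^T *m A^T = row_mx Ah^T 0 by rewrite -trmx_mul AT tr_col_mx trmx0.
have NTT k : T^T *m (N k)^T = row_mx (Nh k)^T (M k)^T.
  by rewrite -trmx_mul NT tr_col_mx.
have sum_row (X : 'I_m -> 'M[R]_(r + q, r)) (Y : 'I_m -> 'M[R]_(r + q, q)) :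
    \sum_(k < m) row_mx (X k) (Y k) = row_mx (\sum_(k < m) X k) (\sum_(k < m) Y k).
  elim: (index_enum _) => [|k s IH]; first by rewrite !big_nil row_mx0.
  by rewrite !big_cons IH add_row_mx.
have e1 : \tr (C *m Sigma *m C^T) = b1 + \tr (S2 *m (dsubmx B *m (dsubmx B)^T)).
  rewrite tr_output_gram reach mulmxN raddfN opprK /=.
  rewrite -{1 2}[B]vsubmxK tr_col_mx mul_mx_row tr_block_diag.
  by rewrite !mul_col_mx col_mxKu col_mxKd.
have e2 : \tr (C *m Pg *m (C *m T)^T) = b1 + \tr (S2 *m (dsubmx (A *m Pg) *m E^T))
    - \tr (S2 *m (\sum_(k < m) dsubmx (N k *m Pg) *m (M k)^T)).
  rewrite trmx_mul !mulmxA -(mulmxA C) tr_output_gram /lyap.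
  under eq_bigr do rewrite -!mulmxA NTT !mul_mx_row.
  rewrite -(mulmxA Pg T^T) ATT mulmxA TT !mul_mx_row sum_row !add_row_mx.
  rewrite mulmx0 addr0 mulmx1 tr_block_diag.
  under eq_bigr do rewrite mulmxA.
  (* The block paired with [S1] is the upper part of the equation for [Pg], which gives
     [- B1 B1^T]. *)
  have -> : usubmx (A *m Pg + Pg *m Ah^T + \sum_(k < m) N k *m Pg *m (Nh k)^T) =
      - (usubmx B *m (usubmx B)^T).
    by rewrite hPg raddfN /= mul_usub_mx.
  have -> : dsubmx (A *m Pg *m - E^T + \sum_(k < m) N k *m (Pg *m (M k)^T)) =
      \sum_(k < m) dsubmx (N k *m Pg) *m (M k)^T - dsubmx (A *m Pg) *m E^T.
    rewrite raddfD /= mulmxN raddfN raddf_sum /= mul_dsub_mx addrC.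
    by congr (_ - _); apply: eq_bigr => k _; rewrite mul_dsub_mx mulmxA.
  rewrite mulmxN mulmxBr raddfN raddfB /=.
  by rewrite (mulmxA S2 _ E^T) -/b1; ring.
have e3 : \tr (C *m T *m Phat *m (C *m T)^T) =
    b1 - \tr (S2 *m (\sum_(k < m) M k *m Phat *m (M k)^T)).
  rewrite trmx_mul !mulmxA -(mulmxA _ Phat) -(mulmxA C) tr_output_gram /lyap.
  have tr_col_row (a : 'M[R]_r) b c (d : 'M[R]_(r, q)) :
      \tr (Sigma *m (col_mx a b *m row_mx c d))
      = \tr (S1 *m (a *m c)) + \tr (S2 *m (b *m d)).
    rewrite mul_col_row mulmx_block mxtrace_block.
    by rewrite !mul0mx addr0 add0r.
  rewrite !mulmxDr !raddfD /= mulmx_sumr [\tr (\sum_(k < m) _)]raddf_sum /=.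
  (* The zero lower block of [A T] removes every [S2] term of the drift; only the [M k] remain
     against [S2]. *)
  have -> : \tr (Sigma *m (A *m (T *m (Phat *m T^T)))) = \tr (S1 *m (Ah *m Phat)).
    rewrite (mulmxA A) AT TT mul_mx_row tr_col_row.
    by rewrite mulmx1 mul0mx mulmx0 mxtrace0 addr0.
  have -> : \tr (Sigma *m (T *m (Phat *m T^T) *m A^T)) = \tr (S1 *m (Phat *m Ah^T)).
    rewrite -!mulmxA ATT mul_mx_row tr_col_row.
    by rewrite mul1mx !mulmx0 mxtrace0 addr0.
  under eq_bigr do rewrite (mulmxA (N _)) NT -!mulmxA NTT mul_mx_row tr_col_row.
  have trS s (S : 'M[R]_s) (F : 'I_m -> 'M[R]_s) :
      \sum_(k < m) \tr (S *m F k) = \tr (S *m \sum_(k < m) F k).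
    by rewrite mulmx_sumr raddf_sum.
  rewrite big_split /= !trS.
  have := congr1 (fun X => \tr (S1 *m X)) hPhat; rewrite /lyap mulmxN raddfN /= -/b1.
  rewrite !mulmxDr !raddfD /=.
  under eq_bigr do rewrite -mulmxA.
  under [in X in _ -> _ = X]eq_bigr do rewrite -mulmxA.
  by move=> h; lra.
rewrite e1 e2 e3.
rewrite !mulmxDr !mulmxN !mulr2n !mulmxDr !raddfD /= !raddfN /=.
ring.
Qed.

End SingularPerturbation.

(** * Assembly for the balanced realization *)

Lemma pdmx_diag {R : realType} {n} (d : 'rV[R]_n) :
  (forall i, 0 < d 0 i) -> pdmx (diag_mx d).
Proof.
move=> d0 v v0.
have -> : qform (diag_mx d) v v = \sum_i d 0 i * v i 0 ^+ 2.
  rewrite /qform mxE; apply: eq_bigr => i _.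
  by rewrite mul_mx_diag !mxE expr2 mulrAC mulrC.
have [i vi] : exists i, v i 0 != 0.
  apply/existsP; apply: contraNT v0 => /existsPn h.
  by apply/eqP/matrixP => i j; rewrite ord1 mxE; have /negPn/eqP := h i.
rewrite (bigD1 i) //= ltr_pwDl //.
  by rewrite mulr_gt0 // lt_def sqrf_eq0 vi sqr_ge0.
by apply: sumr_ge0 => j _; rewrite mulr_ge0 ?sqr_ge0 // ltW.
Qed.

Theorem theorem5p2 (R : realType) (r q m p : nat)
  (A : 'M[R]_(r + q)) (B : 'M[R]_(r + q, m)) (C : 'M[R]_(p, r + q))
  (N : 'I_m -> 'M[R]_(r + q)) (sigma : 'rV[R]_(r + q))
  (Phat : 'M[R]_r) (Pg : 'M[R]_(r + q, r))
  (u : R -> 'cV[R]_m) (x : R -> 'cV[R]_(r + q)) (xh : R -> 'cV[R]_r) :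
  let Sigma := diag_mx sigma in
  let A11 := ulsubmx A in let A12 := ursubmx A in
  let A21 := dlsubmx A in let A22 := drsubmx A in
  let B1 := usubmx B in let B2 := dsubmx B in
  let C1 := lsubmx C in let C2 := rsubmx C in
  let N11 := fun k => ulsubmx (N k) in let N12 := fun k => ursubmx (N k) in
  let N21 := fun k => dlsubmx (N k) in let N22 := fun k => drsubmx (N k) in
  let Sigma2 := drsubmx Sigma in
  let E := invmx A22 *m A21 in
  let Ahat := A11 - A12 *m E in
  let Bhat := B1 in
  let Chat := C1 - C2 *m E in
  let Nhat := fun k => N11 k - N12 k *m E in
  let Pg1 := usubmx Pg in let Pg2 := dsubmx Pg in
  let M := fun k => N21 k - N22 k *m E in
  let K := B2 *m B2^T - ((A22 *m Pg2 + A21 *m Pg1) *m E^T) *+ 2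
           + (\sum_(k < m) (N22 k *m Pg2 + N21 k *m Pg1) *m (M k)^T) *+ 2
           - \sum_(k < m) M k *m Phat *m (M k)^T in
  (* stability of the full bilinear system *)
  spectrum_in_Cminus (bilin_kron A N) ->
  (* balanced realization: P = Q = Sigma = diag(sigma_1..sigma_n) > 0 *)
  (forall i, 0 < sigma 0 i) ->
  A *m Sigma + Sigma *m A^T + \sum_(k < m) N k *m Sigma *m (N k)^T = - (B *m B^T) ->
  A^T *m Sigma + Sigma *m A + \sum_(k < m) (N k)^T *m Sigma *m N k = - (C^T *m C) ->
  (* A22^{-1} exists (presupposed by the SPA formulas) *)
  A22 \in unitmx ->
  ~ zero_in_spectrum (bilin_kron Ahat Nhat) ->
  (* Phat and Pg solve their (generalized) Lyapunov equations *)
  Ahat *m Phat + Phat *m Ahat^T + \sum_(k < m) Nhat k *m Phat *m (Nhat k)^T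
    = - (Bhat *m Bhat^T) ->
  A *m Pg + Pg *m Ahat^T + \sum_(k < m) N k *m Pg *m (Nhat k)^T
    = - (B *m Bhat^T) ->
  (* input in L^2, full and reduced states with zero initial conditions *)
  is_L2 u ->
  bilin_solution A B N u x ->
  bilin_solution Ahat Bhat Nhat u xh ->
  forall t : R, 0 <= t ->
    vnorm2 (C *m x t - Chat *m xh t)
      <= Num.sqrt (\tr (Sigma2 *m K))
         * expR (2^-1 * L2norm2_u0 N u) * Num.sqrt (L2norm2 u).
Proof.
move=> Sigma A11 A12 A21 A22 B1 B2 C1 C2 N11 N12 N21 N22 Sigma2 E Ahat Bhat Chat
  Nhat Pg1 Pg2 M K spec pos hP hQ uA22 nz hPhat hPg L2u hx hxh t t0.
pose S1 := diag_mx (lsubmx sigma).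
have SigmaE : Sigma = block_mx S1 0 0 Sigma2.
  have e : Sigma = block_mx S1 0 0 (diag_mx (rsubmx sigma)).
    by rewrite -diag_mx_row hsubmxK.
  by rewrite /Sigma2 e block_mxKdr.
have Sigma2E : Sigma2 = diag_mx (rsubmx sigma).
  by rewrite /Sigma2 /Sigma -[sigma]hsubmxK diag_mx_row block_mxKdr hsubmxK.
have sSigma : Sigma^T = Sigma by rewrite tr_diag_mx.
have sS1 : S1^T = S1 by rewrite tr_diag_mx.
have sS2 : Sigma2^T = Sigma2 by rewrite Sigma2E tr_diag_mx.
have pSigma : pdmx Sigma by exact: pdmx_diag.
have pS1 : pdmx S1 by apply: pdmx_diag => i; rewrite mxE.
have pS2 : pdmx Sigma2 by rewrite Sigma2E; apply: pdmx_diag => i; rewrite mxE.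
pose T : 'M[R]_(r + q, r) := col_mx 1%:M (- E).
(* The lower block is [A21 - A22 A22^-1 A21 = 0]. *)
have AT : A *m T = col_mx Ahat 0.
  rewrite -[A in LHS]submxK mul_block_col !mulmx1 !mulmxN.
  by rewrite [drsubmx A *m E]mulKVmx // subrr.
have NT k : N k *m T = col_mx (Nhat k) (M k).
  by rewrite -[N k in LHS]submxK mul_block_col !mulmx1 !mulmxN.
have CT : C *m T = Chat.
  by rewrite -[C in LHS]hsubmxK mul_row_col mulmx1 mulmxN.
have reach : lyap A N Sigma = - (B *m B^T) by [].
have obs : lyap A^T (trf N) Sigma = - (C^T *m C).
  rewrite -hQ /lyap /trf trmxK; congr (_ + _).
  by apply: eq_bigr => k _; rewrite trmxK.
have uK : bilin_kron A N \in unitmx.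
  by apply: unitmx_zero_in_spectrum => /spec; rewrite raddf0 ltxx.
have uKh : bilin_kron Ahat Nhat \in unitmx by exact: unitmx_zero_in_spectrum.
(* [Sigma] is a primal supersolution by the reachability equation; the reduced block below uses [S1]
   as a dual one. *)
have [Y [sY pY LY]] : exists Y, [/\ Y^T = Y, pdmx Y & lyap A N Y = - 1%:M].
  apply: (lyap_neg_pd _ _ Sigma) => // v.
  by rewrite reach qform_mxN qform_gram oppr_le0 sqnorm_ge0.
have [Y' [sY' pY' LY']] :
    exists Y, [/\ Y^T = Y, pdmx Y & lyap Ahat Nhat Y = - 1%:M].
  apply: (lyap_neg_pd_dual _ _ S1) => // v.
  rewrite SigmaE in obs.
  apply: (lyap_dual_reduced_le0 A C N S1 Sigma2 E Ahat Nhat M) => //.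
  exact: pdmx_psd.
(* Symmetry is not assumed; it follows from unique solvability of the reduced equation. *)
have sPhat : Phat^T = Phat.
  apply: (lyap_inj Ahat Nhat uKh); rewrite -lyap_tr.
  by rewrite [lyap _ _ _]hPhat raddfN /= trmx_mul trmxK.
have N0 k : N k = 0 -> Nhat k = 0.
  by move=> h; rewrite /Nhat /N11 /N12 h /ulsubmx /ursubmx !raddf0 mul0mx subr0.
have [gap0 gap] := error_bound _ _ _ _ _ _ _ _ _ _ _ sSigma reach sY pY LY
  sPhat hPhat sY' pY' LY' hPg C Chat u x xh t N0 L2u hx hxh t0.
move: gap0 gap; rewrite -CT.
have -> : \tr (C *m Sigma *m C^T) - \tr (C *m Pg *m (C *m T)^T) *+ 2
    + \tr (C *m T *m Phat *m (C *m T)^T) = \tr (Sigma2 *m K).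
  have := tr_gap A B C N S1 Sigma2 E Ahat Nhat M AT NT.
  rewrite -SigmaE => /(_ obs reach Phat Pg hPhat hPg) ->.
  have dsubE (X : 'M[R]_(r + q)) :
      dsubmx (X *m Pg) = drsubmx X *m Pg2 + dlsubmx X *m Pg1.
    by rewrite -[X in LHS]submxK -[Pg in LHS]vsubmxK mul_block_col col_mxKd addrC.
  rewrite dsubE (eq_bigr (fun k => (N22 k *m Pg2 + N21 k *m Pg1) *m (M k)^T)) //.
  by move=> k _; rewrite dsubE.
rewrite CT => gap0 gap.
have -> : vnorm2 (C *m x t - Chat *m xh t)
    = Num.sqrt (sqnorm (C *m x t - Chat *m xh t)).
  by rewrite sqnormE.
(* The factor one half comes from taking the square root of the squared-error bound. *)
have -> : expR (2^-1 * L2norm2_u0 N u) = Num.sqrt (expR (L2norm2_u0 N u)).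
  rewrite -[LHS]ger0_norm ?expR_ge0 // -sqrtr_sqr expr2 -expRD.
  by congr (Num.sqrt (expR _)); lra.
rewrite -mulrA -sqrtrM ?expR_ge0 // -sqrtrM //.
by apply: ler_wsqrtr; rewrite [expR _ * _]mulrC.
Qed.
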